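(* The $\{2,4,6\}$-Hamiltonian cycle problem can be solved in linear time, and when a $\{2,4,6\}$-Hamiltonian cycle exists, one can be constructed in linear time.
   Context: All graphs are finite, simple, undirected, without self-loops, non-empty and connected. A walk of length $k$ in $G$ is a sequence of vertices $(u_0,\dots,u_k)$ with consecutive vertices adjacent; vertices may repeat. For $S \subseteq \mathbb{N}^+$, an $S$-Hamiltonian cycle of $G$ is a sequence $(v_1,\dots,v_n)$ listing every vertex of $G$ exactly once such that for each $i<n$, and also for the pair $(v_n,v_1)$, the two vertices are joined by a walk in $G$ whose length lies in $S$. The $\{2,4,6\}$-Hamiltonian cycle problem asks, given a graph $G$, whether $G$ admits a $\{2,4,6\}$-Hamiltonian cycle. *)

(* Defs.v *)
From mathcomp Require Import all_boot.

Set Implicit Arguments.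
Unset Strict Implicit.
Unset Printing Implicit Defensive.

(* Vertices are numbered: the graph is going to be the input of a machine. *)
Record graph := Graph {
  nb_vertices : nat;
  edge : rel 'I_nb_vertices;
  nb_vertices_gt0 : 0 < nb_vertices;
  edge_sym : symmetric edge;
  edge_irr : irreflexive edge;
  edge_connected : forall u v, connect edge u v }.

Definition vertex (G : graph) := 'I_(nb_vertices G).

Definition nb_edges (G : graph) :=
  #|[set uv : 'I_(nb_vertices G) * 'I_(nb_vertices G)
      | (uv.1 < uv.2) && edge uv.1 uv.2]|.

Definition graph_size (G : graph) := nb_vertices G + nb_edges G.

Definition walk (G : graph) (k : nat) (u v : vertex G) :=
  exists p : seq (vertex G), [/\ path (@edge G) u p, last u p = v & size p = k].

Definition joined (S : {pred nat}) (G : graph) (u v : vertex G) :=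
  exists2 k, k \in S & walk k u v.

(* The index i.+1 %% size c closes the cycle; when c has a single vertex, that
   vertex has to be joined to itself by a walk of length in S. *)
Definition hamiltonian_cycle (S : {pred nat}) (G : graph) (c : seq (vertex G)) :=
  [/\ uniq c, (forall v, v \in c)
    & forall x0 i, i < size c ->
        joined S (nth x0 c i) (nth x0 c (i.+1 %% size c))].

Definition hamiltonian (S : {pred nat}) (G : graph) :=
  exists c : seq (vertex G), hamiltonian_cycle S c.

(* Random access machine with unit-cost instructions. Registers and memory cells
   are both indexed by nat; a program, being finite, uses a fixed number of
   registers. *)
Inductive instr :=
  | IConst of nat & nat         (* IConst r k    : r := k                 *)
  | IMove of nat & nat          (* IMove r a     : r := a                 *)
  | IAdd of nat & nat & nat     (* IAdd r a b    : r := a + b             *)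
  | ISub of nat & nat & nat     (* ISub r a b    : r := a - b (truncated) *)
  | ILoad of nat & nat          (* ILoad r a     : r := memory[a]         *)
  | IStore of nat & nat         (* IStore a b    : memory[a] := b         *)
  | IJump of nat                (* IJump l       : go to l                *)
  | IJumpLt of nat & nat & nat  (* IJumpLt a b l : if a < b, go to l      *)
  | IJumpEq of nat & nat & nat  (* IJumpEq a b l : if a = b, go to l      *)
  | IWrite of nat               (* IWrite a      : append a to the output *)
  | IHalt.

Definition program := seq instr.

Record state := State {
  pc : nat;
  reg : nat -> nat;
  memory : nat -> nat;
  output : seq nat }.

Definition upd (f : nat -> nat) (i x : nat) := fun j => if j == i then x else f j.

(* Words hold the numbers up to W. The machine gets stuck rather than put a
   larger number in a register, so every number it computes, reads, stores or
   uses as an address is at most W. *)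
Definition set_reg (W r x : nat) (s : state) : option state :=
  if x <= W then Some (State (pc s).+1 (upd (reg s) r x) (memory s) (output s))
  else None.

Definition goto (l : nat) (s : state) := State l (reg s) (memory s) (output s).

Definition step (W : nat) (i : instr) (s : state) : option state :=
  match i with
  | IConst r k => set_reg W r k s
  | IMove r a => set_reg W r (reg s a) s
  | IAdd r a b => set_reg W r (reg s a + reg s b) s
  | ISub r a b => set_reg W r (reg s a - reg s b) s
  | ILoad r a => set_reg W r (memory s (reg s a)) s
  | IStore a b =>
      Some (State (pc s).+1 (reg s) (upd (memory s) (reg s a) (reg s b)) (output s))
  | IJump l => Some (goto l s)
  | IJumpLt a b l => Some (goto (if reg s a < reg s b then l else (pc s).+1) s)
  | IJumpEq a b l => Some (goto (if reg s a == reg s b then l else (pc s).+1) s)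
  | IWrite a =>
      Some (State (pc s).+1 (reg s) (memory s) (rcons (output s) (reg s a)))
  | IHalt => None
  end.

(* exec W p t s = Some out iff p, started in s, reaches IHalt after at most t
   steps, with out on its output tape. Leaving the program is not halting. *)
Fixpoint exec (W : nat) (p : program) (t : nat) (s : state) : option (seq nat) :=
  match onth p (pc s) with
  | None => None
  | Some IHalt => Some (output s)
  | Some i => if t is t'.+1 then obind (exec W p t') (step W i s) else None
  end.

Definition init (input : seq nat) : state :=
  State 0 (fun=> 0) (nth 0 input) [::].

Definition adjacency_lists (G : graph) (adj : vertex G -> seq (vertex G)) :=
  forall u, uniq (adj u) /\ forall v, (v \in adj u) = edge u v.

(* Cell 0 holds n; for v <= n, cell v.+1 holds the address a_v such that the
   neighbours of v < n occupy the cells a_v, ..., a_(v+1) - 1. *)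
Definition encode (G : graph) (adj : vertex G -> seq (vertex G)) : seq nat :=
  let n := nb_vertices G in
  let lists := [seq map val (adj v) | v <- enum 'I_n] in
  n :: [seq n.+2 + sumn (take v (shape lists)) | v <- iota 0 n.+1]
    ++ flatten lists.

(* Linear time on the word RAM: the number of steps is at most c * (n + m), and
   so is the largest number in a word, i.e. words have log(n + m) + O(1) bits.
   The order of the neighbours in the adjacency lists is arbitrary. *)
Definition runs_in_linear_time (p : program) (D : graph -> Prop)
    (spec : graph -> seq nat -> Prop) :=
  exists c : nat, forall (G : graph) (adj : vertex G -> seq (vertex G)),
    D G -> adjacency_lists adj ->
    exists2 out,
      exec (c * graph_size G) p (c * graph_size G) (init (encode adj)) = Some out
      & spec G out.

Definition solvable_in_linear_time (P : graph -> Prop) :=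
  exists p, runs_in_linear_time p (fun=> True)
    (fun G out => exists2 b : bool, out = [:: nat_of_bool b] & b <-> P G).

Definition constructible_in_linear_time
    (R : forall G : graph, seq (vertex G) -> Prop) :=
  exists p, runs_in_linear_time p (fun G => exists c, R G c)
    (fun G out => exists2 c : seq (vertex G), out = map val c & R G c).

Definition S246 : {pred nat} := [pred k in [:: 2; 4; 6]].

(* Main.v *)
(* A walk of length 2, 4 or 6 is a path of length 1, 2 or 3 in the graph of the
   walks of length 2. That graph is connected as soon as G is {2,4,6}-Hamiltonian;
   conversely, the cube of a connected graph with at least 3 vertices is
   Hamiltonian: in a rooted tree, list the vertices of even depth before their
   descendants and those of odd depth after them; consecutive vertices are at
   distance at most 3. Here the tree is spanned by the nodes at even depth of a
   depth-first search of the bipartite double cover of G, so a single linear-time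
   search lists the cycle: a vertex is listed on entry at depths 0 mod 4 and on
   exit at depths 2 mod 4. With at least two vertices, G is {2,4,6}-Hamiltonian
   iff this list contains all of them. *)

Require Import Defs.
From mathcomp Require Import all_boot zify.

Set Implicit Arguments.
Unset Strict Implicit.
Unset Printing Implicit Defensive.

(** * Depth-first search of the bipartite double cover *)

Section Near.

Variable G : graph.
Implicit Types u v w : vertex G.

(** Distance at most [k] in the graph whose edges are the walks of length 2. *)
Definition near k u v := exists2 j, j <= k & walk j.*2 u v.

Lemma near_refl k u : near k u u.
Proof. by exists 0 => //; exists [::]. Qed.

Lemma near_edge k u w x v : edge w x -> edge x v -> near k u w -> near k.+1 u v.
Proof.
move=> wx xv [j jk [p [pp pw sp]]]; exists j.+1 => //.
exists (p ++ [:: x; v]); rewrite cat_path last_cat size_cat pp pw /= wx xv sp.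
by split=> //; lia.
Qed.

(** Distinct endpoints rule out the empty walk; the other lengths left are exactly 2, 4 and 6. *)
Lemma near_joined u v : near 3 u v -> u != v -> joined S246 u v.
Proof.
case=> [[|j]] j3 uv neq_uv.
  by case: uv => [[|x p] [] //= _ eq_uv _]; rewrite eq_uv eqxx in neq_uv.
by exists j.+1.*2 => //; case: j j3 {uv} => [|[|[|]]].
Qed.

Lemma nearW k l u v : k <= l -> near k u v -> near l u v.
Proof. by move=> kl [j jk uv]; exists j => //; apply: leq_trans kl. Qed.

End Near.

Section DepthFirstSearch.

Variables (G : graph) (adj : vertex G -> seq (vertex G)).
Hypothesis adjP : adjacency_lists adj.

Definition frame : Type := vertex G * seq (vertex G).

(* The search explores the bipartite double cover of G: the visited node
   (v, b) is v reached by a walk whose length has parity b. A frame (v, r) of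
   the stack, whose top comes first, keeps the neighbours r of v that are still
   to be tried. *)
Record search := Search {
  visited : {set vertex G * bool};
  stack : seq frame;
  listed : seq (vertex G) }.

Definition source : vertex G := Ordinal (nb_vertices_gt0 G).

Definition start :=
  Search [set (source, false)] [:: (source, adj source)] [:: source].

(** The top vertex has depth [size s] and its child lies one deeper: hence the parity
    [~~ odd (size s)] and, for a child entered at depth 0 mod 4, the residue 3. *)
Definition advance st :=
  match stack st with
  | [::] => st
  | (v, [::]) :: s =>
      Search (visited st) s
        (if size s %% 4 == 2 then rcons (listed st) v else listed st)
  | (v, w :: r) :: s =>
      if (w, ~~ odd (size s)) \in visited st
      then Search (visited st) ((v, r) :: s) (listed st)
      else Search ((w, ~~ odd (size s)) |: visited st)
             ((w, adj w) :: (v, r) :: s)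
             (if size s %% 4 == 3 then rcons (listed st) w else listed st)
  end.

(** The parity of a frame's depth tells to which of the two copies of its vertex the frame
    belongs. *)
Fixpoint pending (s : seq frame) v b w :=
  if s is (u, r) :: s' then
    [&& u == v, odd (size s') == b & w \in r] || pending s' v b w
  else false.

(** These vertices will be listed on exit; counting them in advance lets [listed ++ due] match the
    visited even nodes at every moment. *)
Fixpoint due (s : seq frame) :=
  if s is (v, _) :: s' then
    if size s' %% 4 == 2 then v :: due s' else due s'
  else [::].

(* p is the last vertex listed. At an even depth it is near the top of the
   stack, at an odd depth near the vertex below. *)
Definition top_near (s : seq frame) p :=
  match s with
  | [::] => near 1 p source
  | (u, _) :: s' =>
      match size s' %% 4, s' with
      | 0, _ => near 1 p u
      | 1, (u', _) :: _ => near 1 p u'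
      | 2, _ => near 2 p u
      | _, (u', _) :: _ => near 2 p u'
      | _, [::] => False
      end
  end.

Fixpoint chained (s : seq frame) :=
  match s with
  | [::] => true
  | [:: (u, _)] => u == source
  | (u, _) :: ((v, _) :: _) as s' => edge v u && chained s'
  end.

Definition is_tail (f : frame) := exists k, f.2 = drop k (adj f.1).

(** The invariant of the search. Once the stack is empty nothing is pending, so the visited nodes
    are closed under edges, nothing is due, and [listed_top] joins the last listed vertex to
    [source], which closes the cycle. *)
Record consistent st : Prop := Consistent {
  visited_root : (source, false) \in visited st;
  visited_closed : forall v b w, (v, b) \in visited st -> edge v w ->
    ((w, ~~ b) \in visited st) || pending (stack st) v b w;
  listed_uniq : uniq (listed st ++ due (stack st));
  listed_visited : forall v,
    (v \in listed st ++ due (stack st)) = ((v, false) \in visited st);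
  listed_root : exists l, listed st = source :: l;
  listed_near : forall i, i.+1 < size (listed st) ->
    near 3 (nth source (listed st) i) (nth source (listed st) i.+1);
  listed_top : top_near (stack st) (last source (listed st));
  stack_chained : chained (stack st);
  stack_tails : forall f, f \in stack st -> is_tail f }.

Lemma consistent_start : consistent start.
Proof.
split=> //=.
- by rewrite inE.
- by move=> v b w; rewrite !inE => /eqP[-> ->]; rewrite -(adjP source).2 eqxx => ->; rewrite orbT.
- by move=> v; rewrite !inE xpair_eqE eqxx andbT.
- by exists [::].
- exact: near_refl.
- by move=> f; rewrite inE => /eqP->; exists 0; rewrite drop0.
Qed.

(** * Preservation of the invariant *)

Lemma listed_near_rcons l v :
  (forall i, i.+1 < size l -> near 3 (nth source l i) (nth source l i.+1)) ->
  near 3 (last source l) v ->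
  forall i, i.+1 < size (rcons l v) ->
    near 3 (nth source (rcons l v) i) (nth source (rcons l v) i.+1).
Proof.
move=> near_l near_v i; rewrite size_rcons ltnS => il.
rewrite !nth_rcons il; case: (ltngtP i.+1 (size l)) => [|//|eq_il]; first by move=> /near_l.
  by move=> lt_li; move: il; rewrite leqNgt lt_li.
by rewrite -(nth_last source) -eq_il in near_v.
Qed.

Lemma edge_tail v w r : is_tail (v, w :: r) -> edge v w.
Proof.
by case=> k /= def_r; rewrite -(adjP v).2; apply: (@mem_drop k); rewrite -def_r mem_head.
Qed.

Lemma tail_behead v w r : is_tail (v, w :: r) -> is_tail (v, r).
Proof. by case=> k /= def_r; exists k.+1; rewrite /= -add1n -drop_drop -def_r /= drop0. Qed.

Lemma consistent_pop vis v s l :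
  consistent (Search vis ((v, [::]) :: s) l) ->
  consistent (Search vis s (if size s %% 4 == 2 then rcons l v else l)).
Proof.
case=> /= vroot vclosed luniq lvis [l' lroot] lnear ltop schain stails.
split=> //=.
- by move=> u b w ub uw; have := vclosed u b w ub uw; rewrite in_nil !andbF.
- by move: luniq; case: eqP => // _; rewrite cat_rcons.
- by move: lvis; case: eqP => // _ lvis u; rewrite cat_rcons.
- by rewrite lroot; case: eqP => _; [exists (rcons l' v) | exists l'].
- case: eqP => [s2|//]; apply: listed_near_rcons => //.
  by move: ltop; rewrite s2; apply: nearW.
- case: s {vclosed luniq lvis stails} schain ltop => [|[u r] s] /=; first by move/eqP->.
  (* By the depth of the new top [u]: after a pop at odd depth the bound already concerns [u]. A
     vertex popped at depth 2 mod 4 was just listed and is one double step from its grandparent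
     [u']. One popped at depth 0 mod 4 passes its bound on to [u'], increased by one. *)
  case/andP=> uv; case Em: (size s %% 4) => [|[|[|[|m]]]]; last by lia.
  + by have ->: (size s).+1 %% 4 = 1 by lia.
  + have ->: (size s).+1 %% 4 = 2 by lia.
    case: s Em => [|[u' r'] s] //= Em /andP[u'u _] _; rewrite last_rcons.
    by apply: (@near_edge _ 0 _ v u); rewrite 1?edge_sym //; apply: near_refl.
  + by have ->: (size s).+1 %% 4 = 3 by lia.
  have ->: (size s).+1 %% 4 = 0 by lia.
  case: s Em => [|[u' r'] s] //= Em /andP[u'u _].
  by apply: (@near_edge _ 1 _ v u); rewrite edge_sym.
- by case: s schain {vclosed luniq lvis ltop stails lnear} => [|[u r] s] //= /andP[].
- by move=> f fs; apply: stails; rewrite inE fs orbT.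
Qed.

Lemma consistent_skip (vis : {set vertex G * bool}) v w r (s : seq frame) l :
  (w, ~~ odd (size s)) \in vis ->
  consistent (Search vis ((v, w :: r) :: s) l) ->
  consistent (Search vis ((v, r) :: s) l).
Proof.
move=> wvis [/= vroot vclosed luniq lvis lroot lnear ltop schain stails].
split=> //=.
- move=> u b w' ub uw'; have := vclosed u b w' ub uw'.
  rewrite inE; case: (w' =P w) => [->|_] //=.
  by case: (odd (size s) =P b) => [<-|_] /=; rewrite ?wvis ?andbF.
- by move=> f; rewrite inE => /orP[/eqP->|fs];
    [apply: (tail_behead (w := w)); apply: stails; rewrite mem_head
    |apply: stails; rewrite inE fs orbT].
Qed.

Lemma consistent_push (vis : {set vertex G * bool}) v w r (s : seq frame) l :
  (w, ~~ odd (size s)) \notin vis ->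
  consistent (Search vis ((v, w :: r) :: s) l) ->
  consistent (Search ((w, ~~ odd (size s)) |: vis) ((w, adj w) :: (v, r) :: s)
    (if size s %% 4 == 3 then rcons l w else l)).
Proof.
move=> wvis [/= vroot vclosed luniq lvis [l' lroot] lnear ltop schain stails].
have vw: edge v w by apply: (@edge_tail v w r); apply: stails; rewrite mem_head.
pose l1 := if size s %% 4 == 3 then rcons l w else l.
pose d0 := due ((v, w :: r) :: s).
(* A child at even depth joins the list at once (depth 0 mod 4) or becomes due (depth 2 mod 4); a
   child at odd depth changes neither. *)
have perm_l1: perm_eq (l1 ++ due ((w, adj w) :: (v, r) :: s))
    (if odd (size s) then w :: l ++ d0 else l ++ d0).
  rewrite /l1 /d0 /=; case Em: (size s %% 4) => [|[|[|[|m]]]]; last by lia.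
  + have ->: (size s).+1 %% 4 = 1 by lia.
    by have ->: odd (size s) = false by lia.
  + have ->: (size s).+1 %% 4 = 2 by lia.
    have ->: odd (size s) by lia.
    by rewrite /= perm_catC /= perm_cons perm_catC.
  + have ->: (size s).+1 %% 4 = 3 by lia.
    by have ->: odd (size s) = false by lia.
  have ->: (size s).+1 %% 4 = 0 by lia.
  have ->: odd (size s) by lia.
  by rewrite /= -cats1 -catA /= perm_sym -cat1s perm_catCA.
split=> //=.
- by rewrite inE vroot orbT.
- move=> u b w'; rewrite !inE => /orP[/eqP[-> ->]|ub] uw'.
    by rewrite eqxx (adjP w).2 uw' /= !eqxx /= orbT.
  have := vclosed u b w' ub uw'; rewrite inE; case: (w' =P w) => [->|_] /=.
    case: (odd (size s) =P b) => [->|_] /=; first by rewrite eqxx.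
    by rewrite ?andbF /= => /orP[->|->]; rewrite !orbT.
  by case/orP=> ->; rewrite !orbT.
- rewrite (perm_uniq perm_l1); case: ifP => // s1 /=.
  by rewrite luniq lvis andbT; move: wvis; rewrite s1.
- move=> u; rewrite (perm_mem perm_l1) !inE xpair_eqE.
  by case: ifP => s1 /=; rewrite ?inE lvis ?andbT ?andbF.
- by rewrite lroot; case: eqP => _; [exists (rcons l' w) | exists l'].
(* The gap of 3 arises here: at depth 3 the last listed vertex is within 2 of the parent [u], and
   the walk [u], [v], [w] adds one double step. *)
- case: eqP => [s3|//]; apply: listed_near_rcons => //.
  move: ltop; rewrite s3.
  case: s {vclosed luniq lvis stails wvis l1 d0 perm_l1} schain s3
    => [|[u r'] s] //= /andP[uv _] _ near_u.
  exact: near_edge uv vw near_u.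
- case Em: (size s %% 4) ltop => [|[|[|[|m]]]]; last by lia.
  + by have ->: (size s).+1 %% 4 = 1 by lia.
  + have ->: (size s).+1 %% 4 = 2 by lia.
    case: s {vclosed luniq lvis stails wvis l1 d0 perm_l1 Em} schain
      => [|[u r'] s] //= /andP[uv _] near_u.
    exact: near_edge uv vw near_u.
  + by have ->: (size s).+1 %% 4 = 3 by lia.
  have ->: (size s).+1 %% 4 = 0 by lia.
  by move=> _; rewrite last_rcons; apply: near_refl.
- by rewrite vw.
- move=> f; rewrite inE => /orP[/eqP->|]; first by exists 0; rewrite drop0.
  rewrite inE => /orP[/eqP->|fs].
    by apply: (tail_behead (w := w)); apply: stails; rewrite mem_head.
  by apply: stails; rewrite inE fs orbT.
Qed.

Lemma consistent_advance st : consistent st -> consistent (advance st).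
Proof.
case: st => vis [|[v [|w r]] s] l //.
- exact: consistent_pop.
- rewrite /advance /=; case: ifPn; [exact: consistent_skip|exact: consistent_push].
Qed.

(* Each step spends a neighbour or a frame, and a new frame is paid by the
   node it visits. *)
Definition potential st :=
  \sum_(x | x \notin visited st) (size (adj x.1)).+1 + \sum_(f <- stack st) (size f.2).+1.

Lemma potential_advance st : stack st != [::] -> potential (advance st) < potential st.
Proof.
case: st => vis [|[v [|w r]] s] l //= _; rewrite /potential /advance /=.
  by rewrite big_cons; lia.
case: ifPn => wvis /=; first by rewrite !big_cons /=; lia.
rewrite !big_cons /= [X in _ < X + _](bigD1 (w, ~~ odd (size s))) //=.
rewrite (eq_bigl (fun x => (x \notin vis) && (x != (w, ~~ odd (size s))))).
  by move: (bigop _ _ _) (bigop _ s _) => a b; lia.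
by move=> x; rewrite !inE negb_or andbC.
Qed.

(** Each frame contributes at least 1 to the potential, which therefore bounds the memory taken by
    the stack as well as the time. *)
Lemma size_stack_potential st : size (stack st) <= potential st.
Proof.
rewrite /potential -sum1_size; apply: leq_trans (leq_addl _ _).
exact: leq_sum.
Qed.

(** Handshake: the adjacent pairs with increasing components are the edges, [swap] carries the other
    pairs onto them, and the diagonal is empty. *)
Lemma sum_degrees : \sum_v size (adj v) = (nb_edges G).*2.
Proof.
have card_adj v : size (adj v) = \sum_(w | edge v w) 1.
  rewrite sum1_card -(card_uniqP (adjP v).1).
  by apply: eq_card => w; rewrite (adjP v).2.
rewrite (eq_bigr _ (fun v _ => card_adj v)) pair_big_dep /=.
rewrite (bigID (fun x : vertex G * vertex G => x.1 < x.2)) /= -addnn.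
congr (_ + _); rewrite sum1_card.
  by apply: eq_card => x; rewrite !inE andbC.
pose swap (x : vertex G * vertex G) := (x.2, x.1).
have swapK: involutive swap by case.
rewrite -(card_imset _ (can_inj swapK)); apply: eq_card => -[u v].
rewrite -[X in (X \in _) = _]swapK (mem_imset _ _ (can_inj swapK)).
rewrite inE /= /in_mem /= edge_sym; case: ltngtP => [_|_|/val_inj->]; rewrite ?andbT ?andbF //.
by rewrite edge_irr.
Qed.

Lemma potential_start : potential start <= 4 * nb_edges G + 2 * nb_vertices G.
Proof.
rewrite /potential /= big_cons big_nil.
(* The initial frame costs exactly what the visited node [(source, false)] no longer contributes. *)
have ->: \sum_(x | x \notin [set (source, false)]) (size (adj x.1)).+1 + ((size (adj source)).+1 + 0)
   = \sum_(x : vertex G * bool) (size (adj x.1)).+1.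
  rewrite [RHS](bigD1 (source, false)) //= addn0 addnC; congr (_ + _).
  by apply: eq_bigl => x; rewrite inE.
rewrite -(pair_big xpredT xpredT (fun v (b : bool) => (size (adj v)).+1)) /=.
rewrite (eq_bigr (fun v => 2 * size (adj v) + 2)); last first.
  by move=> v _; rewrite big_bool /=; move: (size _) => k; lia.
rewrite big_split /= -big_distrr sum_degrees sum_nat_const card_ord.
by rewrite -[X in X + _]/(2 * (nb_edges G).*2); lia.
Qed.

(** A duplicate-free list of full size misses no vertex; [listed_near] serves the inner pairs and
    [listed_top] the closing one. With two vertices or more, the members of each pair differ, as
    [near_joined] requires. *)
Lemma listed_hamiltonian st : consistent st -> stack st = [::] ->
  nb_vertices G != 1 -> size (listed st) = nb_vertices G ->
  hamiltonian_cycle S246 (listed st).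
Proof.
case: st => vis s l [/= _ _ luniq _ [l' lroot] lnear ltop _ _] s0 n1 sl.
move: luniq ltop; rewrite s0 cats0 /= => luniq ltop.
have size_gt1 : 1 < size l by rewrite sl ltn_neqAle eq_sym n1 nb_vertices_gt0.
split=> // [v|x0 i il].
  have /setP/(_ v): [set x in l] = setT; last by rewrite !inE.
  by apply/eqP; rewrite eqEcard subsetT cardsT card_ord cardsE (card_uniqP luniq) sl /=.
rewrite !(set_nth_default source x0) ?ltn_pmod ?(ltnW size_gt1) //.
have [Si|Si] := ltnP i.+1 (size l).
  rewrite modn_small //; apply: near_joined (lnear i Si) _.
  by rewrite nth_uniq // neq_ltn ltnSn.
have ->: i = (size l).-1 by lia.
rewrite prednK ?modnn; last by lia.
have l0: nth source l 0 = source by rewrite lroot.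
rewrite nth_last; apply: near_joined; first by rewrite l0; apply: nearW _ ltop.
by rewrite -nth_last nth_uniq //; case: (size l) size_gt1 => [|[]].
Qed.

Lemma visited_walk st v b k w : consistent st -> stack st = [::] ->
  (v, b) \in visited st -> walk k v w -> (w, b (+) odd k) \in visited st.
Proof.
move=> cst s0 + [p [pp <- <-]].
elim: p v b pp => [|x p IHp] v b /=; first by rewrite addbF.
case/andP=> vx px vb; rewrite addbN -addNb; apply: IHp => //.
by have := visited_closed cst vb vx; rewrite s0 orbF.
Qed.

Lemma hamiltonian_listed st : consistent st -> stack st = [::] ->
  hamiltonian S246 G ->
  nb_vertices G != 1 /\ size (listed st) = nb_vertices G.
Proof.
move=> cst s0 [c [cuniq call cjoined]].
have c_gt0: 0 < size c by rewrite lt0n size_eq0; case: c call {cuniq cjoined} => // /(_ source).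
have size_c: size c = nb_vertices G.
  by rewrite -(card_uniqP cuniq) -[RHS]card_ord; apply: eq_card => v; rewrite call.
split.
  (* On a single vertex, a walk of positive length would begin with a loop. *)
  apply/negP=> /eqP n1.
  have [k + [p [+ _ sp]]] := cjoined source 0 c_gt0.
  case: p sp => [<-//|v p _ _ /= /andP[+ _]].
  rewrite (_ : v = nth source c 0) ?edge_irr //.
  by apply: val_inj; move: (ltn_ord v) (ltn_ord (nth source c 0)) => /=; lia.
(* All lengths in [S246] are even, so following the cycle from a node of parity [false] meets only
   visited nodes of parity [false]. *)
have visc k i : i < size c -> (nth source c i, false) \in visited st ->
   (nth source c ((i + k) %% size c), false) \in visited st.
  move=> ic vi; elim: k => [|k IHk]; first by rewrite addn0 modn_small.
  have lt_ik: (i + k) %% size c < size c by rewrite ltn_pmod.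
  have [j Sj ij] := cjoined source _ lt_ik.
  have oj : odd j = false by move: Sj; rewrite !inE => /or3P[] /eqP->.
  by have := visited_walk cst s0 IHk ij; rewrite oj -addn1 modnDml addn1 addnS.
have {}visc v : (v, false) \in visited st.
  have vc := call v; have rc := call source.
  (* The shift from the position of [source] to that of [v]; the full turn [size c] keeps the
     difference from being truncated. *)
  have := visc (size c - index source c + index v c) (index source c).
  rewrite index_mem rc nth_index // visited_root // => /(_ isT isT).
  rewrite addnA subnKC ?index_size // modnDl modn_small ?index_mem //.
  by rewrite nth_index.
have luniq := listed_uniq cst; have lvis := listed_visited cst.
rewrite s0 cats0 /= in luniq; rewrite -(card_uniqP luniq) -[RHS]card_ord.
by apply: eq_card => v; have := lvis v; rewrite s0 cats0 => ->; rewrite visc.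
Qed.

End DepthFirstSearch.

(** * The input of the machine *)

Section Encoding.

Variables (G : graph) (adj : vertex G -> seq (vertex G)).
Hypothesis adjP : adjacency_lists adj.

Local Notation n := (nb_vertices G).
Local Notation lists := [seq map val (adj v) | v <- enum 'I_n].

Definition address v := n.+2 + sumn (take v (shape lists)).

Lemma nth_encodeS v : v <= n -> nth 0 (encode adj) v.+1 = address v.
Proof.
move=> vn; rewrite -[LHS]/(nth 0 (_ ++ flatten lists) v) nth_cat size_map size_iota ltnS vn.
by rewrite (nth_map 0) ?size_iota // nth_iota.
Qed.

Lemma size_lists : size lists = n.
Proof. by rewrite size_map size_enum_ord. Qed.

Lemma size_shape : size (shape lists) = n.
Proof. by rewrite size_map size_lists. Qed.

Lemma nth_lists (v : vertex G) : nth [::] lists v = map val (adj v).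
Proof. by rewrite (nth_map v) ?size_enum_ord // nth_ord_enum. Qed.

Lemma nth_shape (v : vertex G) : nth 0 (shape lists) v = size (adj v).
Proof.
by rewrite (nth_map [::]) ?size_lists // nth_lists size_map.
Qed.

Lemma addressS (v : vertex G) : address v.+1 = address v + size (adj v).
Proof.
rewrite /address (take_nth 0) ?size_shape // sumn_rcons nth_shape.
by rewrite addnA.
Qed.

Lemma nth_encode_adj (v : vertex G) k x0 : k < size (adj v) ->
  nth 0 (encode adj) (address v + k) = nth x0 (adj v) k.
Proof.
move=> kv; rewrite /encode /address.
rewrite -cat1s catA nth_cat size_cat size_map size_iota /=.
rewrite ifF; last by lia.
have ->: n.+2 + sumn (take v (shape lists)) + k - (1 + n.+1)
  = flatten_index (shape lists) v k by rewrite /flatten_index; lia.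
rewrite nth_flatten flatten_indexKl ?flatten_indexKr ?nth_shape //.
by rewrite nth_lists (nth_map x0).
Qed.

Lemma address_max : address n = n.+2 + 2 * nb_edges G.
Proof.
rewrite /address take_oversize ?size_shape //.
rewrite sumnE 2!big_map big_enum /= mul2n -(sum_degrees adjP).
by under eq_bigr do rewrite size_map.
Qed.

Lemma size_encode : size (encode adj) = address n.
Proof.
rewrite /address take_oversize ?size_shape //.
by rewrite /= size_cat size_map size_iota size_flatten; lia.
Qed.

Lemma address_le v : address v <= address n.
Proof.
rewrite {2}/address take_oversize ?size_shape //.
by rewrite /address leq_add2l -[X in _ <= sumn X](cat_take_drop v) sumn_cat leq_addr.
Qed.

(** The untried neighbours form a suffix of an adjacency list, so one address, counted back from the
    end of the list, encodes them. *)
Definition pointer (f : frame G) := address f.1.+1 - size f.2.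

Lemma pointer_adj v : pointer (v, adj v) = address v.
Proof. by rewrite /pointer /= addressS addnK. Qed.

Lemma tail_size f : is_tail adj f -> size f.2 <= size (adj f.1).
Proof. by case=> k ->; rewrite size_drop leq_subr. Qed.

Lemma pointer_nil v : pointer (v, [::]) = address v.+1.
Proof. by rewrite /pointer subn0. Qed.

Lemma pointer_cons v w r : is_tail adj (v, w :: r) ->
  [/\ pointer (v, w :: r) < address v.+1,
      pointer (v, r) = (pointer (v, w :: r)).+1
    & nth 0 (encode adj) (pointer (v, w :: r)) = w].
Proof.
move=> vr; have := tail_size vr; rewrite /pointer /= addressS => le_r.
split; try lia.
case: vr => k /= def_r; have := congr1 size def_r; rewrite size_drop /= => size_r.
rewrite (_ : _ - _ = address v + k); last by lia.
rewrite (nth_encode_adj v); last by lia.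
by rewrite -[k]addn0 -nth_drop -def_r.
Qed.

End Encoding.

(** * The search on the machine *)

Lemma eq_upd (f : nat -> nat) i x j : j != i -> upd f i x j = f j.
Proof. by rewrite /upd => /negPf->. Qed.

(** * Execution rules for single instructions *)

Section ExecutionRules.

Variables (W : nat) (p : program).
Implicit Types (i t : nat) (rg m : nat -> nat) (o : seq nat) (res : option (seq nat)).

(** Lets program branches of different lengths share one time bound. *)
Lemma exec_mono t t' s out :
  exec W p t s = Some out -> t <= t' -> exec W p t' s = Some out.
Proof.
elim: t t' s => [|t IHt] t' s; first by case: t' => // t'; cbn [exec]; case: onth => [[]|].
case: t' => // t'; cbn [exec]; have mono_bind X :
    obind (exec W p t) X = Some out -> t < t'.+1 -> obind (exec W p t') X = Some out.
  by case: X => //= s'; apply: IHt.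
by case: onth => [[]|] //; move=> *; apply: mono_bind.
Qed.

Lemma exec_const t i rg m o res r k :
  onth p i = Some (IConst r k) -> k <= W ->
  exec W p t (State i.+1 (upd rg r k) m o) = res ->
  exec W p t.+1 (State i rg m o) = res.
Proof. by move=> /= -> /= kW <-; rewrite /set_reg kW. Qed.

Lemma exec_move t i rg m o res r a x :
  onth p i = Some (IMove r a) -> rg a = x -> x <= W ->
  exec W p t (State i.+1 (upd rg r x) m o) = res ->
  exec W p t.+1 (State i rg m o) = res.
Proof. by move=> /= -> /= -> xW <-; rewrite /set_reg xW. Qed.

Lemma exec_add t i rg m o res r a b x :
  onth p i = Some (IAdd r a b) -> rg a + rg b = x -> x <= W ->
  exec W p t (State i.+1 (upd rg r x) m o) = res ->
  exec W p t.+1 (State i rg m o) = res.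
Proof. by move=> /= -> /= -> xW <-; rewrite /set_reg xW. Qed.

Lemma exec_sub t i rg m o res r a b x :
  onth p i = Some (ISub r a b) -> rg a - rg b = x -> x <= W ->
  exec W p t (State i.+1 (upd rg r x) m o) = res ->
  exec W p t.+1 (State i rg m o) = res.
Proof. by move=> /= -> /= -> xW <-; rewrite /set_reg xW. Qed.

Lemma exec_load t i rg m o res r a x :
  onth p i = Some (ILoad r a) -> m (rg a) = x -> x <= W ->
  exec W p t (State i.+1 (upd rg r x) m o) = res ->
  exec W p t.+1 (State i rg m o) = res.
Proof. by move=> /= -> /= -> xW <-; rewrite /set_reg xW. Qed.

Lemma exec_store t i rg m o res a b x y :
  onth p i = Some (IStore a b) -> rg a = x -> rg b = y ->
  exec W p t (State i.+1 rg (upd m x y) o) = res ->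
  exec W p t.+1 (State i rg m o) = res.
Proof. by move=> /= -> /= -> -> <-. Qed.

Lemma exec_jump t i rg m o res l :
  onth p i = Some (IJump l) ->
  exec W p t (State l rg m o) = res ->
  exec W p t.+1 (State i rg m o) = res.
Proof. by move=> /= ->. Qed.

Lemma exec_jump_lt t i rg m o res a b l x y :
  onth p i = Some (IJumpLt a b l) -> rg a = x -> rg b = y ->
  exec W p t (State (if x < y then l else i.+1) rg m o) = res ->
  exec W p t.+1 (State i rg m o) = res.
Proof. by move=> /= -> /= -> ->. Qed.

Lemma exec_jump_eq t i rg m o res a b l x y :
  onth p i = Some (IJumpEq a b l) -> rg a = x -> rg b = y ->
  exec W p t (State (if x == y then l else i.+1) rg m o) = res ->
  exec W p t.+1 (State i rg m o) = res.
Proof. by move=> /= -> /= -> ->. Qed.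

Lemma exec_write t i rg m o res a x :
  onth p i = Some (IWrite a) -> rg a = x ->
  exec W p t (State i.+1 rg m (rcons o x)) = res ->
  exec W p t.+1 (State i rg m o) = res.
Proof. by move=> /= -> /= ->. Qed.

Lemma exec_halt t i rg m o :
  onth p i = Some IHalt -> exec W p t (State i rg m o) = Some o.
Proof. by case: t => [|t] /= ->. Qed.

End ExecutionRules.

Local Arguments exec : simpl never.

Local Notation rZero := 0 (only parsing).
Local Notation rOne := 1 (only parsing).
Local Notation rTwo := 2 (only parsing).
Local Notation rFour := 3 (only parsing).
Local Notation rN := 4 (only parsing).
Local Notation rEnd := 5 (only parsing).
Local Notation rMarks := 6 (only parsing).
Local Notation rFlip := 7 (only parsing).
Local Notation rBase := 8 (only parsing).
Local Notation rTop := 9 (only parsing).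
Local Notation rV := 10 (only parsing).
Local Notation rNext := 11 (only parsing).
Local Notation rLast := 12 (only parsing).
Local Notation rDepth := 13 (only parsing).
Local Notation rCount := 14 (only parsing).
Local Notation rW := 15 (only parsing).
Local Notation rAddr := 16 (only parsing).
Local Notation rMark := 17 (only parsing).

Local Notation loop := 14 (only parsing).
Local Notation pop := 36 (only parsing).
Local Notation rest := 44 (only parsing).
Local Notation finish := 53 (only parsing).

Definition emit (decide : bool) :=
  if decide then IAdd rCount rCount rOne else IWrite rV.

(* After the input come the marks of the nodes (v, false), those of the nodes
   (v, true), and the stack. rMarks is the base of the marks for the parity of the
   children of the current node, and rFlip - rMarks the base for the other parity.
   rDepth is the depth modulo 4. *)
Definition search_program (decide : bool) : program :=
  [:: IConst rOne 1; IConst rTwo 2; IConst rFour 4;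
      ILoad rN rZero; IAdd rAddr rN rOne; ILoad rEnd rAddr;
      IAdd rMarks rEnd rN; IAdd rFlip rMarks rEnd;
      IAdd rBase rMarks rN; IMove rTop rBase;
      IStore rEnd rOne; ILoad rNext rOne; ILoad rLast rTwo;
      emit decide;
      (* 14: loop *)
      IJumpEq rNext rLast pop;
      ILoad rW rNext; IAdd rNext rNext rOne;
      IAdd rAddr rMarks rW; ILoad rMark rAddr; IJumpEq rMark rOne loop;
      IStore rAddr rOne;
      IStore rTop rV; IAdd rTop rTop rOne;
      IStore rTop rNext; IAdd rTop rTop rOne;
      IMove rV rW;
      IAdd rAddr rV rOne; ILoad rNext rAddr;
      IAdd rAddr rAddr rOne; ILoad rLast rAddr;
      ISub rMarks rFlip rMarks;
      IAdd rDepth rDepth rOne; IJumpLt rDepth rFour loop;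
      IConst rDepth 0; emit decide; IJump loop;
      (* 36: pop *)
      IJumpEq rDepth rTwo 40; IJumpEq rDepth rZero 43;
      ISub rDepth rDepth rOne; IJump rest;
      (* 40 *)
      emit decide; IConst rDepth 1; IJump rest;
      (* 43 *)
      IConst rDepth 3;
      (* 44: rest *)
      IJumpEq rTop rBase finish;
      ISub rTop rTop rOne; ILoad rNext rTop;
      ISub rTop rTop rOne; ILoad rV rTop;
      IAdd rAddr rV rTwo; ILoad rLast rAddr;
      ISub rMarks rFlip rMarks; IJump loop]
  (* 53: finish *)
  ++ if decide then
       [:: IJumpEq rN rOne 55; IJumpEq rCount rN 57;
           IWrite rZero; IHalt; IWrite rOne; IHalt]
     else [:: IHalt].

(** * Simulation of the search by the program *)

Section Simulation.

Variables (G : graph) (adj : vertex G -> seq (vertex G)).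
Hypothesis adjP : adjacency_lists adj.
Variables (decide : bool) (W P : nat).

Local Notation n := (nb_vertices G).
Local Notation first_mark := (address adj n).
Local Notation stack_base := (first_mark + 2 * n).
Local Notation run := (exec W (search_program decide)).

(** The value of [rFlip], the sum of the two mark bases, must fit in a word; the next hypothesis
    does the same for stack addresses up to [P] frames. *)
Hypothesis W_marks : 2 * first_mark + n <= W.
Hypothesis W_stack : stack_base + 2 * P + 4 <= W.

(** Only the frames below the top are in memory, two cells each, with the bottom frame lowest; the
    top frame lives in registers. *)
Fixpoint saved (m : nat -> nat) (s : seq (frame G)) : Prop :=
  if s is f :: s' then
    [/\ m (stack_base + 2 * size s') = f.1,
        m (stack_base + 2 * size s').+1 = pointer adj f
      & saved m s']
  else True.

Lemma eq_saved m m' s :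
  (forall i, stack_base <= i < stack_base + 2 * size s -> m' i = m i) ->
  saved m s -> saved m' s.
Proof.
elim: s => //= f s IHs eq_m [m1 m2 ms].
rewrite !eq_m ?m1 ?m2; try lia.
by split=> //; apply: IHs ms => i i_s; apply: eq_m; lia.
Qed.

Lemma first_mark_gt : n.+1 < first_mark.
Proof. exact: leq_addr. Qed.

Record constants (rg : nat -> nat) : Prop := Constants {
  reg_zero : rg rZero = 0;
  reg_one : rg rOne = 1;
  reg_two : rg rTwo = 2;
  reg_four : rg rFour = 4;
  reg_n : rg rN = n;
  reg_end : rg rEnd = first_mark;
  reg_flip : rg rFlip = 2 * first_mark + n;
  reg_base : rg rBase = stack_base }.

Definition emitted (rg : nat -> nat) (o : seq nat) (l : seq (vertex G)) :=
  if decide then rg rCount = size l /\ o = [::] else o = map val l.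

Record top_frame (rg : nat -> nat) (f : frame G) (s : seq (frame G)) : Prop :=
  TopFrame {
  reg_v : rg rV = f.1;
  reg_next : rg rNext = pointer adj f;
  reg_last : rg rLast = address adj f.1.+1;
  reg_depth : rg rDepth = size s %% 4;
  reg_top : rg rTop = stack_base + 2 * size s;
  reg_marks : rg rMarks = first_mark + ~~ odd (size s) * n }.

Record data (m : nat -> nat) (vis : {set vertex G * bool}) (s : seq (frame G)) : Prop :=
  Data {
  input_kept : forall i, i < first_mark -> m i = nth 0 (encode adj) i;
  marks_visited : forall (v : vertex G) (b : bool),
    m (first_mark + b * n + v) = ((v, b) \in vis);
  saved_stack : saved m s }.

Record represents (st : search G) (s : state) : Prop := Represents {
  represents_constants : constants (reg s);
  represents_listed : emitted (reg s) (output s) (listed st);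
  represents_stack :
    match stack st with
    | [::] => pc s = finish
    | f :: fs =>
        [/\ pc s = loop, top_frame (reg s) f fs & data (memory s) (visited st) fs]
    end }.

(** Abstracting over the resulting registers and output treats counting and writing at once. *)
Lemma exec_emit t i rg m o l res (v : vertex G) :
  onth (search_program decide) i = Some (emit decide) ->
  rg rOne = 1 -> rg rV = v -> emitted rg o l -> size l < W ->
  (forall rg' o', (forall j, j != rCount -> rg' j = rg j) ->
     emitted rg' o' (rcons l v) -> run t (State i.+1 rg' m o') = res) ->
  run t.+1 (State i rg m o) = res.
Proof.
rewrite /emitted /emit => pi one_rg v_rg; case: decide pi => pi.
  move=> [cnt ->] lW H; apply: (exec_add pi) (erefl _) _ _; first by rewrite one_rg; lia.
  apply: H => [j /negPf|]; first by rewrite /upd => ->.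
  by rewrite /upd /= cnt one_rg addn1 size_rcons.
move=> -> lW H; apply: (exec_write pi) v_rg _.
by apply: H => //; rewrite map_rcons.
Qed.

Lemma constants_eq rg rg' :
  (forall j, j < 9 -> j != 6 -> rg' j = rg j) -> constants rg -> constants rg'.
Proof. by move=> eq_rg []; split; rewrite eq_rg. Qed.

(** The return to the frame below: [rDepth] already holds the depth of that frame, [size s - 1]
    modulo 4, while [rMarks] still belongs to the frame being left. *)
Lemma run_rest vis s l t rg m o out :
  constants rg -> emitted rg o l -> data m vis s ->
  rg rDepth = (size s + 3) %% 4 -> rg rTop = stack_base + 2 * size s ->
  rg rMarks = first_mark + ~~ odd (size s) * n -> size s <= P ->
  (forall s', represents (Search vis s l) s' -> run t s' = Some out) ->
  run (9 + t) (State rest rg m o) = Some out.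
Proof.
move=> crg eo [min mvis msaved] rd rt rm sP H.
have [r0 r1 r2 r4 rn re rf rb] := crg.
rewrite !addSn add0n; apply: (exec_jump_eq _ rt rb); first reflexivity.
rewrite -[X in _ == X]addn0 eqn_add2l muln_eq0 /=.
case: s => [|[u r] s] /= in msaved rd rt rm sP H *.
  by apply: (@exec_mono _ _ t); [apply: H; split|lia].
have [m1 m2 ms] := msaved.
have au := address_le adj u.+2.
have le_ptr: pointer adj (u, r) <= first_mark.
  by apply: leq_trans (leq_subr _ _) _; apply: address_le.
have un := ltn_ord u; have n_mark := first_mark_gt.
apply: (exec_sub (x := (stack_base + 2 * size s).+1)); [reflexivity|lia|lia|].
apply: exec_load; [reflexivity|exact: m2|lia|].
apply: (exec_sub (x := stack_base + 2 * size s)); [reflexivity|rewrite /upd /=; lia|lia|].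
apply: exec_load; [reflexivity|exact: m1|lia|].
apply: (exec_add (x := u.+2)); [reflexivity|rewrite /upd /=; lia|lia|].
apply: (exec_load (x := address adj u.+1)); [reflexivity| |by have := address_le adj u.+1; lia|].
  by rewrite /upd /= min ?nth_encodeS //; lia.
(* [rFlip] is the sum of the two mark bases, so subtracting one yields the other. *)
apply: (exec_sub (x := first_mark + ~~ odd (size s) * n)); [reflexivity| |by case: odd; lia|].
  by rewrite /upd /= rf rm; case: odd => /=; lia.
apply: exec_jump; first reflexivity.
apply: (@exec_mono _ _ t); last by lia.
apply: H; split=> //=; split=> //; split; rewrite /upd //=; lia.
Qed.

Lemma run_pop vis v s l t rg m o out :
  constants rg -> emitted rg o l -> top_frame rg (v, [::]) s -> data m vis s ->
  size s <= P -> let l' := if size s %% 4 == 2 then rcons l v else l in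
  size l' <= n ->
  (forall s', represents (Search vis s l') s' -> run t s' = Some out) ->
  run (14 + t) (State loop rg m o) = Some out.
Proof.
move=> crg eo tf dm sP l' ln H; have [/= rv rp rq rd rt rm] := tf.
have [r0 r1 r2 r4 rn re rf rb] := crg.
have n_mark := first_mark_gt.
(* At most five instructions lead to [rest], and nine follow. *)
rewrite -[14 + t]/(9 + t).+1.+4; apply: (exec_jump_eq _ rp rq); first reflexivity.
rewrite pointer_nil eqxx.
apply: (exec_jump_eq _ rd r2); first reflexivity.
move: ln H; rewrite {}/l'; case: ifPn => [/eqP d2|d2].
  rewrite size_rcons => ln H.
  apply: (exec_emit (v := v)); [reflexivity|by []|by []|exact: eo|lia|].
  move=> rg' o' rg'E eo'.
  apply: exec_const; [reflexivity|lia|].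
  apply: exec_jump; first reflexivity.
  apply: run_rest H => //; rewrite /upd /= ?rg'E //; last by lia.
  by apply: constants_eq crg => j j9 j6; rewrite ifN ?rg'E; lia.
move=> ln H.
apply: (exec_jump_eq _ rd r0); first reflexivity.
case: ifPn => [/eqP d0|d0].
  apply: exec_const; [reflexivity|lia|].
  apply: (@exec_mono _ _ (9 + t)); last by lia.
  by apply: run_rest H => //; rewrite /upd /=; lia.
apply: (exec_sub (x := (size s %% 4).-1)); [reflexivity|lia|lia|].
apply: exec_jump; first reflexivity.
by apply: run_rest H => //; rewrite /upd /=; lia.
Qed.

Lemma run_try vis v w r s l t rg m o out :
  is_tail adj (v, w :: r) ->
  constants rg -> emitted rg o l -> top_frame rg (v, w :: r) s -> data m vis s ->
  size s < P -> let st := advance adj (Search vis ((v, w :: r) :: s) l) in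
  size (listed st) <= n ->
  (forall s', represents st s' -> run t s' = Some out) ->
  run (22 + t) (State loop rg m o) = Some out.
Proof.
move=> vr crg eo tf [min mvis msaved] sP st ln H.
have [/= rv rp rq rd rt rm] := tf.
have [r0 r1 r2 r4 rn re rf rb] := crg.
have n_mark := first_mark_gt.
have [ptr_lt ptrS ptr_w] := pointer_cons vr.
have le_v := address_le adj v.+1; have wn := ltn_ord w.
(* The longest path, a push that also lists the child, takes 22 instructions. *)
rewrite !addSn add0n; apply: (exec_jump_eq _ rp rq); first reflexivity.
rewrite ifN; last by rewrite neq_ltn ptr_lt.
apply: (exec_load (x := w)); [reflexivity|by rewrite rp min ?ptr_w //; lia|lia|].
apply: (exec_add (x := pointer adj (v, r))); [reflexivity|by rewrite /upd /=; lia|lia|].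
set a := first_mark + ~~ odd (size s) * n + w.
have aW : first_mark <= a < stack_base by rewrite /a; case: odd; lia.
apply: (exec_add (x := a)); [reflexivity|by rewrite /upd /= rm|lia|].
apply: (exec_load (x := (w, ~~ odd (size s)) \in visited (Search vis s l)));
  [reflexivity|by rewrite /upd /= mvis|by case: in_mem; lia|].
apply: (exec_jump_eq (x := (w, ~~ odd (size s)) \in vis) (y := 1)); [reflexivity|reflexivity|exact: r1|].
move: ln H; rewrite {}/st /advance /=; case: ifP => wvis /= ln H.
  apply: (@exec_mono _ _ t); last by lia.
  apply: H; split=> //=; split=> //=; split=> //; lia.
pose b := ~~ odd (size s).
pose top := stack_base + 2 * size s.
(* The memory after a push: the child is marked, then the frame [(v, r)] is saved. *)
pose m' := upd (upd (upd m a 1) top v) top.+1 (pointer adj (v, r)).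
have dm' : data m' ((w, b) |: vis) ((v, r) :: s).
  split=> /=.
  - by move=> i i_lt; rewrite /m' !eq_upd ?min // /top; lia.
  - move=> u c; have un := ltn_ord u.
    have uc_lt : first_mark + c * n + u < stack_base by case: (c); lia.
    rewrite /m' [LHS]eq_upd; last by rewrite /top; lia.
    rewrite eq_upd; last by rewrite /top; lia.
    rewrite !inE; case: eqP => [[-> ->]|neq_uc]; first by rewrite /upd eqxx.
    (* Vertex numbers are below [n], so a mark's cell determines both parity and vertex. *)
    rewrite eq_upd ?mvis //; apply/eqP => eq_a; apply: neq_uc.
    have eq_cb : c = b by move: eq_a; rewrite /a -/b; case: (c) (b) => [] []; lia.
    by congr (_, _); [apply: val_inj; move: eq_a; rewrite /a -/b eq_cb /=; lia|].
  - split; first by rewrite /m' eq_upd /upd ?eqxx // /top; lia.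
      by rewrite /m' /upd /top eqxx.
    by apply: eq_saved msaved => i i_s; rewrite /m' !eq_upd // /top; lia.
have dm'_input := input_kept dm'.
have le_w := address_le adj w; have le_w1 := address_le adj w.+1.
apply: (exec_store (x := a) (y := 1)); [reflexivity|reflexivity|exact: r1|].
apply: (exec_store (x := top) (y := v)); [reflexivity|by rewrite /upd /= rt|by rewrite /upd /= rv|].
apply: (exec_add (x := top.+1)); [reflexivity|by rewrite /upd /= rt r1 addn1|rewrite /top; lia|].
apply: (exec_store (x := top.+1) (y := pointer adj (v, r))); [reflexivity|reflexivity|reflexivity|].
rewrite -/m'.
apply: (exec_add (x := top.+2)); [reflexivity|by rewrite /upd /= r1 addn1|rewrite /top; lia|].
apply: (exec_move (x := w)); [reflexivity|by []|lia|].
apply: (exec_add (x := w.+1)); [reflexivity|by rewrite /upd /= r1 addn1|lia|].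
apply: (exec_load (x := address adj w)); [reflexivity|rewrite /upd /=|lia|].
  by rewrite dm'_input ?nth_encodeS //; lia.
apply: (exec_add (x := w.+2)); [reflexivity|by rewrite /upd /= r1 addn1|lia|].
apply: (exec_load (x := address adj w.+1)); [reflexivity|rewrite /upd /=|lia|].
  by rewrite dm'_input ?nth_encodeS //; lia.
apply: (exec_sub (x := first_mark + ~~ b * n)); [reflexivity|rewrite /upd /= rf rm -/b
  |by case: (b); lia|].
  by case: (b) => /=; lia.
apply: (exec_add (x := (size s %% 4).+1)); [reflexivity|by rewrite /upd /= rd r1 addn1|lia|].
apply: (exec_jump_lt (x := (size s %% 4).+1) (y := 4)); [reflexivity|reflexivity|exact: r4|].
case: ltnP => d3.
  apply: (@exec_mono _ _ t); last by lia.
  apply: H; have -> : (size s %% 4 == 3) = false by lia.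
  split=> //=; split=> //; split; rewrite /upd //= ?pointer_adj /top; lia.
move: ln H; have -> : size s %% 4 == 3 by lia.
rewrite size_rcons => ln H.
apply: exec_const; [reflexivity|lia|].
apply: (exec_emit (v := w)); [reflexivity|by []|by []|exact: eo|lia|].
move=> rg' o' rg'E eo'.
apply: exec_jump; first reflexivity.
apply: (@exec_mono _ _ t); last by lia.
apply: H; split=> //=.
  by split; rewrite rg'E.
split=> //; split; rewrite rg'E // /upd //= ?pointer_adj /top; lia.
Qed.

Lemma run_start t out :
  (forall s', represents (start adj) s' -> run t s' = Some out) ->
  run (14 + t) (init (encode adj)) = Some out.
Proof.
move=> H; rewrite !addSn add0n /init.
have n_mark := first_mark_gt; have n_gt0 := nb_vertices_gt0 G.
pose m' := upd (nth 0 (encode adj)) first_mark 1.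
have dm' : data m' [set (source G, false)] [::].
  split=> [i i_lt|v b|//]; first by rewrite /m' eq_upd //; lia.
  rewrite inE /m'; case: eqP => [[-> ->]|neq_vb].
    by rewrite /upd ifT //; apply/eqP => /=; lia.
  (* Cells beyond the input read the default 0, so every other mark starts cleared. *)
  rewrite eq_upd ?nth_default ?size_encode; try lia.
  apply/eqP => eq_mark; apply: neq_vb; congr (_, _); last by case: b eq_mark => //=; lia.
  by apply: val_inj => /=; lia.
have le_a1 := address_le adj 1.
apply: exec_const; [reflexivity|lia|].
apply: exec_const; [reflexivity|lia|].
apply: exec_const; [reflexivity|lia|].
apply: (exec_load (x := n)); [reflexivity|reflexivity|lia|].
apply: (exec_add (x := n.+1)); [reflexivity|by rewrite /upd /= addn1|lia|].
apply: (exec_load (x := first_mark)); [reflexivity|exact: nth_encodeS|lia|].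
apply: (exec_add (x := first_mark + n)); [reflexivity|reflexivity|lia|].
apply: (exec_add (x := 2 * first_mark + n)); [reflexivity|by rewrite /upd /=; lia|lia|].
apply: (exec_add (x := stack_base)); [reflexivity|by rewrite /upd /=; lia|lia|].
apply: (exec_move (x := stack_base)); [reflexivity|reflexivity|lia|].
apply: (exec_store (x := first_mark) (y := 1)); [reflexivity|reflexivity|reflexivity|].
rewrite -/m'.
apply: (exec_load (x := address adj 0)); [reflexivity|rewrite /upd /=
  |by have := address_le adj 0; lia|].
  by rewrite (input_kept dm') ?nth_encodeS //; lia.
apply: (exec_load (x := address adj 1)); [reflexivity|rewrite /upd /=|lia|].
  by rewrite (input_kept dm') ?nth_encodeS //; lia.
apply: (exec_emit (v := source G) (l := [::])); [reflexivity|reflexivity|reflexivity| |by rewrite /=; lia|].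
  by rewrite /emitted; case: decide.
move=> rg' o' rg'E eo'.
apply: H; split=> //=; first by split; rewrite rg'E.
by split=> //; split; rewrite rg'E // /upd /= ?pointer_adj //; lia.
Qed.

(** The test [n != 1] excludes the one-vertex graph, whose list is complete although its vertex has
    no walk of positive length to itself. *)
Definition answer (st : search G) : seq nat :=
  if decide then [:: nat_of_bool ((n != 1) && (size (listed st) == n))]
  else map val (listed st).

Lemma run_finish t st s : stack st = [::] -> represents st s ->
  run (4 + t) s = Some (answer st).
Proof.
case: s => i rg m o st0 [/= [r0 r1 _ _ rn _ _ _] eo]; rewrite st0 => ->.
move: eo; rewrite !addSn add0n /emitted /answer.
case: decide => [[cnt ->]|->]; last exact: exec_halt.
apply: (exec_jump_eq _ rn r1); first reflexivity.
case: eqP => _ /=.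
  by apply: (exec_write _ r0); [reflexivity|apply: exec_halt].
apply: (exec_jump_eq _ cnt rn); first reflexivity.
case: eqP => _ /=.
  by apply: (exec_write _ r1); [reflexivity|apply: exec_halt].
by apply: (exec_write _ r0); [reflexivity|apply: exec_halt].
Qed.

Lemma size_listed st : consistent adj st -> size (listed st) <= n.
Proof.
move=> cst; have := listed_uniq cst; rewrite cat_uniq => /andP[/card_uniqP <- _].
by rewrite -[leqRHS]card_ord max_card.
Qed.

(** One round of the program simulates one [advance] in at most 22 instructions and lowers the
    potential; the 4 is for the final test and output. The potential also keeps the stack within [P]
    frames. *)
Lemma run_loop k st : consistent adj st -> potential adj st <= k -> k <= P ->
  exists st', [/\ consistent adj st', stack st' = [::]
    & forall s, represents st s -> run (22 * k + 4) s = Some (answer st')].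
Proof.
elim: k st => [|k IHk] st cst st_k kP; have [st0|st_neq0] := eqVneq (stack st) [::].
- by exists st; split=> // s; apply: (run_finish 0).
- by have := potential_advance adj st_neq0; rewrite ltnNge (leq_trans st_k).
- exists st; split=> // s; rewrite addnC; exact: run_finish.
have cst1 := consistent_advance adjP cst.
have st1_k : potential adj (advance adj st) <= k.
  by rewrite -ltnS; apply: leq_trans st_k; apply: potential_advance.
have [st' [cst' st'0 IH]] := IHk _ cst1 st1_k (ltnW kP).
exists st'; split=> // -[i rg m o] [crg eo].
have le_stack := size_stack_potential adj st; have le_listed := size_listed cst1.
have tails := stack_tails cst.
case: st st_neq0 cst1 st_k {cst st1_k} IH le_stack le_listed tails crg eo
  => vis [|[v [|w r]] s] l //=.
- move=> _ _ st_k IH le_stack le_listed _ crg eo [-> tf dm].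
  apply: (@exec_mono _ _ (14 + (22 * k + 4))); last by lia.
  by apply: run_pop crg eo tf dm _ le_listed IH; lia.
- move=> _ _ st_k IH le_stack le_listed tails crg eo [-> tf dm].
  rewrite (_ : 22 * k.+1 + 4 = 22 + (22 * k + 4)); last by lia.
  apply: run_try crg eo tf dm _ le_listed IH; last by lia.
  by apply: tails; rewrite mem_head.
Qed.

Lemma run_program : potential adj (start adj) <= P ->
  exists2 st, consistent adj st /\ stack st = [::]
    & run (22 * P + 18) (init (encode adj)) = Some (answer st).
Proof.
move=> start_P.
have [st [cst st0 H]] := run_loop (consistent_start adjP) start_P (leqnn P).
exists st => //; rewrite (_ : _ + 18 = 14 + (22 * P + 4)); last by lia.
exact: run_start.
Qed.

End Simulation.

Lemma exec_search (decide : bool) (G : graph) (adj : vertex G -> seq (vertex G)) :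
  adjacency_lists adj ->
  exists2 st, consistent adj st /\ stack st = [::]
    & exec (110 * graph_size G) (search_program decide) (110 * graph_size G)
        (init (encode adj)) = Some (answer decide st).
Proof.
(* With [m] edges, [22 * P + 18] is [88 * m + 44 * n + 18], at most [110 * (n + m)] as [n] is
   positive; the word bounds are smaller. *)
move=> adjP; pose P := 4 * nb_edges G + 2 * nb_vertices G.
have n_gt0 := nb_vertices_gt0 G; have mark := address_max adjP.
have [|||st cst_st0 H] := @run_program G adj adjP decide (110 * graph_size G) P.
- by rewrite /graph_size; lia.
- by rewrite /graph_size /P; lia.
- exact: potential_start.
by exists st => //; apply: exec_mono H _; rewrite /graph_size /P; lia.
Qed.

Theorem theorem10 :
  solvable_in_linear_time (hamiltonian S246) /\
  constructible_in_linear_time (@hamiltonian_cycle S246).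
Proof.
split.
  exists (search_program true); exists 110 => G adj _ adjP.
  have [st [cst st0] H] := exec_search true adjP.
  eexists; first exact: H.
  eexists; first reflexivity.
  split=> [/andP[n1 /eqP st_n]|].
    by exists (listed st); exact: listed_hamiltonian cst st0 n1 st_n.
  by case/(hamiltonian_listed cst st0) => -> ->; rewrite eqxx.
exists (search_program false); exists 110 => G adj G_ham adjP.
have [st [cst st0] H] := exec_search false adjP.
have [n1 st_n] := hamiltonian_listed cst st0 G_ham.
exists (map val (listed st)) => //; exists (listed st) => //.
exact: listed_hamiltonian cst st0 n1 st_n.
Qed.
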